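(* Let $R=[a,b]\times[c,d]$, fix $\alpha\in\mathcal{C}(R)$ with $\|\alpha\|_\infty<1$ and $m,n\in\mathbb{N}$. The multi-valued mapping $\mathcal{V}^\alpha_{m,n}:\mathcal{C}(R)\rightrightarrows\mathcal{C}(R)$ defined by $$\mathcal{V}^\alpha_{m,n}(f)=\{f^\alpha_{\Delta,B_{m,n}}:\Delta\text{ ranges over all possible nets on }R\}$$ is a process.
   Context: Here $a<b$, $c<d$, and $\mathcal{C}(R)$ is the Banach space of continuous real functions on $R$ with supremum norm $\|\cdot\|_\infty$. Bernstein operator: for $m,n\in\mathbb{N}$ and $f\in\mathcal{C}(R)$, $$B_{m,n}(f)(x,y)=\frac{1}{(b-a)^m(d-c)^n}\sum_{i=0}^m\sum_{j=0}^n f\Big(a+\tfrac{i(b-a)}{m},c+\tfrac{j(d-c)}{n}\Big)\binom{m}{i}\binom{n}{j}(x-a)^i(b-x)^{m-i}(y-c)^j(d-y)^{n-j}.$$ Net: $\Delta=\{(x_i,y_j):0\le i\le N,\ 0\le j\le M\}$ with $a=x_0<x_1<\dots<x_N=b$ and $c=y_0<y_1<\dots<y_M=d$, $N,M\ge2$ (here $N,M$ vary with the net). Put $I=[a,b]$, $J=[c,d]$, $I_i=[x_{i-1},x_i]$, $J_j=[y_{j-1},y_j]$, $R_{ij}=I_i\times J_j$. For $1\le i\le N$, $u_i:I\to I_i$ is a contraction that is a homeomorphism onto $I_i$, with $u_i(x_0)=x_{i-1}$, $u_i(x_N)=x_i$ if $i$ is odd and $u_i(x_0)=x_i$, $u_i(x_N)=x_{i-1}$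 if $i$ is even. For $1\le j\le M$, $v_j:J\to J_j$ is a contraction that is a homeomorphism onto $J_j$, with $v_j(y_0)=y_{j-1}$, $v_j(y_M)=y_j$ if $j$ is odd and $v_j(y_0)=y_j$, $v_j(y_M)=y_{j-1}$ if $j$ is even. For each net a choice of maps $u_i,v_j$ is fixed. Put $Q_{ij}(x,y)=(u_i^{-1}(x),v_j^{-1}(y))$ for $(x,y)\in R_{ij}$. $\alpha$-fractal function: for $f\in\mathcal{C}(R)$ and $\alpha\in\mathcal{C}(R)$ with $\|\alpha\|_\infty<1$, $f^\alpha_{\Delta,B_{m,n}}$ is the unique function in $\mathcal{C}(R)$ satisfying, for all $\boldsymbol{x}\in R_{ij}$, $1\le i\le N$, $1\le j\le M$, $$f^\alpha_{\Delta,B_{m,n}}(\boldsymbol{x})=f(\boldsymbol{x})+\alpha(\boldsymbol{x})f^\alpha_{\Delta,B_{m,n}}(Q_{ij}(\boldsymbol{x}))-\alpha(\boldsymbol{x})B_{m,n}(f)(Q_{ij}(\boldsymbol{x})).$$ It is known that this function exists and is unique and that $f\mapsto f^\alpha_{\Delta,B_{m,n}}$ is bounded and linear. A multi-valued mapping $T:X\rightrightarrows Y$ between normed spaces is a process if $\lambda T(x)=T(\lambda x)$ for all $x\in X$, $\lambda>0$, and $0\in T(0)$. *)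

(* Defs.v *)
From HB Require Import structures.
From mathcomp Require Import all_boot all_order all_algebra.
From mathcomp Require Import all_classical all_reals all_analysis.

Set Implicit Arguments.
Unset Strict Implicit.
Unset Printing Implicit Defensive.

Import Order.TTheory GRing.Theory Num.Theory.
Import numFieldNormedType.Exports.

Local Open Scope classical_set_scope.
Local Open Scope ring_scope.

Definition process (K : realType) (X Y : normedModType K) (T : X -> set Y) :=
  (forall (x : X) (l : K), 0 < l -> [set l *: y | y in T x] = T (l *: x))
  /\ T 0 0.

Definition rectangle (R : realType) (a b c d : R) : set (R * R) :=
  `[a, b] `*` `[c, d].

(* Continuous functions on the subtype of points of the rectangle, which carries
   the topology induced by R * R. *)
Definition Cspace (R : realType) (a b c d : R) : Type :=
  continuousType (rectangle a b c d) R.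

Section Cspace_normed.
Variables (R : realType) (a b c d : R).
Local Notation C := (Cspace a b c d).
Local Notation D := (rectangle a b c d).

HB.instance Definition _ := Choice.copy C (continuousType D R).

Implicit Types f g h : C.

Lemma Cspace_cts f : continuous (f : D -> R).
Proof. exact: (@cts_fun _ _ f). Qed.

Let add_cts f g : continuous (fun t : D => f t + g t).
Proof. by move=> t; exact: (cvgD (@Cspace_cts f t) (@Cspace_cts g t)). Qed.
Let opp_cts f : continuous (fun t : D => - f t).
Proof. by move=> t; exact: (cvgN (@Cspace_cts f t)). Qed.
Let scale_cts (l : R) f : continuous (fun t : D => l * f t).
Proof. by move=> t; exact: (cvgM (cvg_cst l) (@Cspace_cts f t)). Qed.
Let zero_cts : continuous (fun _ : D => 0 : R).
Proof. exact: cst_continuous. Qed.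

Let zero : C := mkcts zero_cts.
Let add f g : C := mkcts (@add_cts f g).
Let opp f : C := mkcts (@opp_cts f).
Let scale (l : R) f : C := mkcts (@scale_cts l f).

Let addA : associative add.
Proof. by move=> f g h; apply/continuousEP => t; exact: addrA. Qed.
Let addC : commutative add.
Proof. by move=> f g; apply/continuousEP => t; exact: addrC. Qed.
Let add0 : left_id zero add.
Proof. by move=> f; apply/continuousEP => t; exact: add0r. Qed.
Let addN : left_inverse zero opp add.
Proof. by move=> f; apply/continuousEP => t; exact: addNr. Qed.

HB.instance Definition _ := GRing.isZmodule.Build C addA addC add0 addN.

Let scaleA (k l : R) f : scale k (scale l f) = scale (k * l) f.
Proof. by apply/continuousEP => t; exact: mulrA. Qed.
Let scale1 : left_id 1 scale.
Proof. by move=> f; apply/continuousEP => t; exact: mul1r. Qed.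
Let scaleDr : right_distributive scale +%R.
Proof. by move=> k f g; apply/continuousEP => t; exact: mulrDr. Qed.
Let scaleDl f : {morph scale^~ f : k l / k + l}.
Proof. by move=> k l; apply/continuousEP => t; exact: mulrDl. Qed.

HB.instance Definition _ :=
  GRing.Zmodule_isLmodule.Build R C scaleA scale1 scaleDr scaleDl.

Lemma Cspace0E (t : D) : (0 : C) t = 0.
Proof. by []. Qed.
Lemma CspaceDE f g (t : D) : (f + g) t = f t + g t.
Proof. by []. Qed.
Lemma CspaceNE f (t : D) : (- f) t = - f t.
Proof. by []. Qed.
Lemma CspaceZE (l : R) f (t : D) : (l *: f) t = l * f t.
Proof. by []. Qed.

Definition supnorm f : R := sup (range (fun t : D => `|f t|)).

Lemma rectangle_compact : compact D.
Proof. by apply: compact_setX; exact: segment_compact. Qed.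

Lemma Cspace_bounded f : exists M, forall t : D, `|f t| <= M.
Proof.
have cf : {within D, continuous (valL (f : D -> R))}.
  by apply/subspace_valL_continuousP; exact: Cspace_cts.
have /compact_bounded [M [_ hM]] := continuous_compact cf rectangle_compact.
exists (M + 1) => t; apply: (hM (M + 1)); first by rewrite ltrDl.
exists (val t); first exact: set_valP.
by rewrite -[in RHS](valLK point (f : D -> R)).
Qed.

Lemma supnorm_ub f (t : D) : `|f t| <= supnorm f.
Proof.
apply: ub_le_sup; last by exists t.
by have [M hM] := Cspace_bounded f; exists M => _ [s _ <-].
Qed.

Lemma supnorm_le f (M : R) : 0 <= M -> (forall t : D, `|f t| <= M) ->
  supnorm f <= M.
Proof.
move=> M0 hM; rewrite /supnorm.
have [->|/set0P ne] := eqVneq (range (fun t : D => `|f t|)) set0.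
  by rewrite sup0.
by apply: ge_sup => // _ [t _ <-].
Qed.

Lemma supnorm_ge0 f : 0 <= supnorm f.
Proof.
have [E|/set0P [_ [t _ _]]] := eqVneq (range (fun t : D => `|f t|)) set0.
  by rewrite /supnorm E sup0.
exact: le_trans (normr_ge0 _) (supnorm_ub f t).
Qed.

Let supnormD f g : supnorm (f + g) <= supnorm f + supnorm g.
Proof.
apply: supnorm_le => [|t]; first by rewrite addr_ge0 ?supnorm_ge0.
by rewrite CspaceDE (le_trans (ler_normD _ _))// lerD ?supnorm_ub.
Qed.

Let supnormZ_le (l : R) f : supnorm (l *: f) <= `|l| * supnorm f.
Proof.
apply: supnorm_le => [|t]; first by rewrite mulr_ge0 ?supnorm_ge0.
by rewrite CspaceZE normrM ler_wpM2l ?supnorm_ub.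
Qed.

Let supnormZ (l : R) f : supnorm (l *: f) = `|l| * supnorm f.
Proof.
apply/eqP; rewrite eq_le supnormZ_le /=.
have [->|l0] := eqVneq l 0; first by rewrite normr0 mul0r supnorm_ge0.
rewrite -ler_pdivlMl ?normr_gt0// -normfV.
by rewrite -[in leLHS](scalerK l0 f) supnormZ_le.
Qed.

Let supnorm0_eq0 f : supnorm f = 0 -> f = 0.
Proof.
move=> f0; apply/continuousEP => t; rewrite Cspace0E.
by apply/eqP; rewrite -normr_le0 -f0 supnorm_ub.
Qed.

HB.instance Definition _ :=
  Lmodule_isNormed.Build R C supnormD supnormZ supnorm0_eq0.

Lemma Cspace_normE f : `|f| = sup (range (fun t : D => `|f t|)).
Proof. by []. Qed.

End Cspace_normed.

(* valL f extends f by 0 off the rectangle; it is only used at points of the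
   rectangle. *)
Definition bernstein (R : realType) (a b c d : R) (m n : nat)
    (f : Cspace a b c d) (p : R * R) : R :=
  ((b - a) ^+ m * (d - c) ^+ n)^-1 *
  \sum_(i < m.+1) \sum_(j < n.+1)
    valL f (a + i%:R * (b - a) / m%:R, c + j%:R * (d - c) / n%:R)
    * 'C(m, i)%:R * 'C(n, j)%:R
    * (p.1 - a) ^+ i * (b - p.1) ^+ (m - i)
    * (p.2 - c) ^+ j * (d - p.2) ^+ (n - j).

(* In itv_partition a b s the left end point a is not listed in s, so the number
   of subintervals is size s. *)
Record net (R : realType) (a b c d : R) := Net {
  net_xs : seq R;
  net_ys : seq R;
  net_xsP : itv_partition a b net_xs;
  net_ysP : itv_partition c d net_ys;
  net_xs_ge2 : (2 <= size net_xs)%N;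
  net_ys_ge2 : (2 <= size net_ys)%N }.

Definition knot (R : realType) (a b : R) (s : seq R) (i : nat) : R :=
  nth b (a :: s) i.

Definition is_contraction_on (R : realType) (A : set R) (w : R -> R) :=
  exists k : R, [/\ 0 <= k, k < 1 & k.-lipschitz_A w].

Definition homeomorphism_on (R : realType) (A B : set R) (w : R -> R) :=
  [/\ set_bij A B w, {within A, continuous w}
    & {within B, continuous (pinv A w)}].

Definition alternating_maps (R : realType) (a b : R) (s : seq R)
    (w : nat -> R -> R) :=
  forall i, (1 <= i <= size s)%N ->
    [/\ is_contraction_on `[a, b] (w i),
        homeomorphism_on `[a, b] `[knot a b s i.-1, knot a b s i] (w i),
        w i a = (if odd i then knot a b s i.-1 else knot a b s i)
      & w i b = (if odd i then knot a b s i else knot a b s i.-1)].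

Section fractal.
Variables (R : realType) (a b c d : R).
Local Notation C := (Cspace a b c d).

(* The maps u_i, v_j chosen for each net; indices outside 1..N, 1..M are
   ignored. *)
Record map_choice := MapChoice {
  umap : net a b c d -> nat -> R -> R;
  vmap : net a b c d -> nat -> R -> R;
  umapP : forall D, alternating_maps a b (net_xs D) (umap D);
  vmapP : forall D, alternating_maps c d (net_ys D) (vmap D) }.

Variable w : map_choice.

Definition cell (D : net a b c d) (i j : nat) : set (R * R) :=
  `[knot a b (net_xs D) i.-1, knot a b (net_xs D) i] `*`
  `[knot c d (net_ys D) j.-1, knot c d (net_ys D) j].

Definition Qmap (D : net a b c d) (i j : nat) (p : R * R) : R * R :=
  (pinv `[a, b] (umap w D i) p.1, pinv `[c, d] (vmap w D j) p.2).

Definition self_referential (alpha : C) (m n : nat) (D : net a b c d)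
    (f g : C) :=
  forall i j, (1 <= i <= size (net_xs D))%N -> (1 <= j <= size (net_ys D))%N ->
  forall p, cell D i j p ->
    valL g p = valL f p + valL alpha p * valL g (Qmap D i j p)
               - valL alpha p * bernstein m n f (Qmap D i j p).

(* Definite description: for `|alpha| < 1 there is exactly one such function, so
   the default value 0 is never used. *)
Definition fractal_function (alpha : C) (m n : nat) (D : net a b c d)
    (f : C) : C :=
  xget 0 [set g | self_referential alpha m n D f g].

Definition fractal_multimap (alpha : C) (m n : nat) (f : C) : set C :=
  [set fractal_function alpha m n D f | D in [set: net a b c d]].

End fractal.

(* Main.v *)
Require Import Defs.
From HB Require Import structures.
From mathcomp Require Import all_boot all_order all_algebra.
From mathcomp Require Import all_classical all_reals all_analysis.
Import Order.TTheory GRing.Theory Num.Theory.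
Import numFieldNormedType.Exports.

Local Open Scope classical_set_scope.
Local Open Scope ring_scope.

(* Two solutions g, h of the self-referential equation for f satisfy
   (g - h)(p) = alpha(p) (g - h)(Q(p)), so `|g - h| <= `|alpha| * `|g - h| and
   g = h.  The equation is homogeneous in (f, g), so by uniqueness
   f |-> f^alpha commutes with nonzero scalars for each net. *)

(** Induction on [s]: either [x] is at most the first listed point [y], or the search continues in
    the partition of [[y, b]] with indices shifted by one. *)
Lemma itv_partition_knot (R : realType) (a b : R) (s : seq R) (x : R) :
  itv_partition a b s -> (0 < size s)%N -> a <= x <= b ->
  exists2 i, (1 <= i <= size s)%N & knot a b s i.-1 <= x <= knot a b s i.
Proof.
elim: s a => // y s IHs a abs _ /andP[ax xb].
have [xy|/ltW yx] := leP x y.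
  by exists 1%N => //=; rewrite /knot /= ax.
have ybs := itv_partition_cons abs.
case: s IHs abs ybs => [_ _|z s IHs _] ybs.
  (* With no points after [y], the partition forces [y = b]. *)
  by exists 1%N => //=; rewrite /knot /= ax (itv_partition_nil ybs).
have [|i /andP[i0 il] ki] := IHs _ ybs isT; first by rewrite yx.
exists i.+1; first by rewrite /= ltnS.
by case: i i0 il ki.
Qed.

Lemma knot_in_itv (R : realType) (a b : R) (s : seq R) (i : nat) :
  itv_partition a b s -> (i <= size s)%N -> a <= knot a b s i <= b.
Proof.
by move=> abs il; rewrite /knot itv_partition_nth_ge// itv_partition_nth_le.
Qed.

Lemma cell_sub_rectangle (R : realType) (a b c d : R) (D : net a b c d) i j :
  (1 <= i <= size (net_xs D))%N -> (1 <= j <= size (net_ys D))%N ->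
  cell D i j `<=` rectangle a b c d.
Proof.
move=> /andP[i0 il] /andP[j0 jl] p [].
have hx := knot_in_itv _ _ _ _ _ (net_xsP D).
have hy := knot_in_itv _ _ _ _ _ (net_ysP D).
have /andP[+ _] := hx i.-1 (leq_trans (leq_pred i) il).
have /andP[_ +] := hx i il.
have /andP[+ _] := hy j.-1 (leq_trans (leq_pred j) jl).
have /andP[_ +] := hy j jl.
rewrite /= !in_itv/= => yd cy xb ax /andP[px1 px2] /andP[py1 py2].
by split; rewrite /= in_itv/= ?(le_trans ax px1) ?(le_trans px2 xb)
  ?(le_trans cy py1) ?(le_trans py2 yd).
Qed.

(** The cells cover the rectangle, so the self-referential equation is available at each of its
    points. *)
Lemma rectangle_cell (R : realType) (a b c d : R) (D : net a b c d) p :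
  rectangle a b c d p ->
  exists i j, [/\ (1 <= i <= size (net_xs D))%N,
    (1 <= j <= size (net_ys D))%N & cell D i j p].
Proof.
case=> /=; rewrite !in_itv/= => px py.
have [i il ki] :=
  itv_partition_knot _ _ _ _ _ (net_xsP D) (ltnW (net_xs_ge2 D)) px.
have [j jl kj] :=
  itv_partition_knot _ _ _ _ _ (net_ysP D) (ltnW (net_ys_ge2 D)) py.
by exists i, j; split => //; split; rewrite /= in_itv.
Qed.

Lemma homeomorphism_pinv (R : realType) (A B : set R) (w : R -> R) x :
  homeomorphism_on A B w -> B x -> A (pinv A w x).
Proof.
case=> wAB _ _; have [pinvBA _ _] := bijpinv_bij (fun=> point) wAB.
exact: pinvBA.
Qed.

(** Ensures that [valL] at [Qmap w D i j p] is a genuine function value, to which norm bounds and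
    linearity apply. *)
Lemma Qmap_rectangle (R : realType) (a b c d : R) (w : map_choice a b c d)
    (D : net a b c d) i j p :
  (1 <= i <= size (net_xs D))%N -> (1 <= j <= size (net_ys D))%N ->
  cell D i j p -> rectangle a b c d (Qmap w D i j p).
Proof.
move=> il jl [px py].
have [_ hu _ _] := umapP w il.
have [_ hv _ _] := vmapP w jl.
by split; [exact: homeomorphism_pinv _ _ _ _ _ hu px|exact: homeomorphism_pinv _ _ _ _ _ hv py].
Qed.

Lemma valL_set_val (U V : Type) (v : V) (A : set U) (f : A -> V) (t : A) :
  valL_ v f (val t) = f t.
Proof. by rewrite -[in RHS](valLK v f). Qed.

Section Cspace_valL.
Variables (R : realType) (a b c d : R).
Local Notation C := (Cspace a b c d).
Local Notation D := (rectangle a b c d).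
Implicit Types f g : C.

Lemma rectangle_set_val p : D p -> exists t : D, val t = p.
Proof. by move=> Dp; exists (exist _ p (mem_set Dp)). Qed.

Lemma CspaceZ_valL (l : R) f p : D p -> valL (l *: f) p = l * valL f p.
Proof. by move=> /rectangle_set_val[t <-]; rewrite !valL_set_val. Qed.

Lemma CspaceB_valL f g p : D p -> valL (f - g) p = valL f p - valL g p.
Proof. by move=> /rectangle_set_val[t <-]; rewrite !valL_set_val. Qed.

Lemma valL_le_norm f p : D p -> `|valL f p| <= `|f|.
Proof.
by move=> /rectangle_set_val[t <-]; rewrite valL_set_val; exact: supnorm_ub.
Qed.

Lemma norm_le_valL f M : 0 <= M -> (forall p, D p -> `|valL f p| <= M) ->
  `|f| <= M.
Proof.
move=> M0 fM; apply: supnorm_le => // t.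
by rewrite -(valL_set_val _ _ point); apply/fM/set_valP.
Qed.

End Cspace_valL.

(** Places the sampling nodes of the Bernstein operator inside the rectangle. *)
Lemma equispaced_in_itv (R : realType) (a b : R) (m i : nat) :
  a <= b -> (0 < m)%N -> (i <= m)%N -> a <= a + i%:R * (b - a) / m%:R <= b.
Proof.
move=> ab m0 im; have m0' : 0 < m%:R :> R by rewrite ltr0n.
have ba : 0 <= b - a by rewrite subr_ge0.
rewrite lerDl divr_ge0 ?mulr_ge0//= addrC -lerBrDr ler_pdivrMr//.
by rewrite mulrC ler_wpM2l// ler_nat.
Qed.

Lemma bernsteinZ (R : realType) (a b c d : R) (m n : nat) (l : R)
    (f : Cspace a b c d) p :
  a <= b -> c <= d -> (0 < m)%N -> (0 < n)%N ->
  bernstein m n (l *: f) p = l * bernstein m n f p.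
Proof.
move=> ab cd m0 n0; rewrite /bernstein mulrCA; congr (_ * _).
rewrite mulr_sumr; apply: eq_bigr => i _.
rewrite mulr_sumr; apply: eq_bigr => j _.
rewrite CspaceZ_valL ?mulrA//.
by split; rewrite /= in_itv/= equispaced_in_itv// -ltnS.
Qed.

Section fractal.
Variables (R : realType) (a b c d : R) (w : map_choice a b c d).
Local Notation C := (Cspace a b c d).
Variables (alpha : C) (m n : nat) (D : net a b c d).

Lemma self_referential_unique (f g h : C) : `|alpha| < 1 ->
  self_referential w alpha m n D f g -> self_referential w alpha m n D f h ->
  g = h.
Proof.
move=> alpha1 sg sh; apply/eqP; rewrite -subr_eq0 -normr_le0.
have le_gh : `|g - h| <= `|alpha| * `|g - h|.
  apply: norm_le_valL => [|p Dp]; first by rewrite mulr_ge0.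
  have [i [j [il jl cp]]] := rectangle_cell _ _ _ _ _ D p Dp.
  have DQ := Qmap_rectangle _ _ _ _ _ w D i j p il jl cp.
  (* In the difference of the two equations the Bernstein terms cancel first, then the values of
     [f]. *)
  rewrite CspaceB_valL// (sg i j)// (sh i j)// opprD addrACA subrr addr0.
  rewrite opprD addrACA subrr add0r -mulrBr -CspaceB_valL//.
  by rewrite normrM ler_pM// valL_le_norm.
(* A positive [|g - h|] would be strictly decreased by the factor [|alpha| < 1], against [le_gh]. *)
rewrite leNgt; apply/negP => gh0.
by move: le_gh; rewrite leNgt gtr_pMl ?alpha1.
Qed.

Hypotheses (ab : a <= b) (cd : c <= d) (m0 : (0 < m)%N) (n0 : (0 < n)%N).

Lemma self_referentialZ (l : R) (f g : C) :
  self_referential w alpha m n D f g ->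
  self_referential w alpha m n D (l *: f) (l *: g).
Proof.
move=> sg i j il jl p cp.
have Dp := cell_sub_rectangle _ _ _ _ _ D i j il jl p cp.
have DQ := Qmap_rectangle _ _ _ _ _ w D i j p il jl cp.
rewrite !CspaceZ_valL// bernsteinZ// (sg i j)// !mulrBr !mulrDr.
by rewrite !(mulrCA l).
Qed.

(* No existence of solutions is needed: if there is none for f, there is none
   for l *: f either, and both sides are the default value 0. *)
Lemma fractal_functionZ (l : R) (f : C) : `|alpha| < 1 -> l != 0 ->
  fractal_function w alpha m n D (l *: f) =
  l *: fractal_function w alpha m n D f.
Proof.
move=> alpha1 l0; rewrite {2}/fractal_function.
case: xgetP => [g _ sg|no_sol].
  apply: xget_unique => [|h sh]; first exact: self_referentialZ.
  exact: self_referential_unique alpha1 sh (self_referentialZ _ _ _ sg).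
(* Scaling by [l^-1] turns a solution for [l *: f] into one for [f]. *)
rewrite scaler0; apply: xgetPN => h /= /(self_referentialZ l^-1).
by rewrite scalerK//; exact: no_sol.
Qed.

End fractal.

(** Supplies a concrete net with two subintervals per side, the fewest a net allows. *)
Lemma itv_partition_mid (R : realType) (a b : R) : a < b ->
  itv_partition a b [:: (a + b) / 2; b].
Proof. by move=> ab; split=> //=; rewrite !midf_lt. Qed.

Theorem theorem3p11 (R : realType) (a b c d : R) (ab : a < b) (cd : c < d)
  (w : map_choice a b c d) (alpha : Cspace a b c d) (alpha_lt1 : `|alpha| < 1)
  (m n : nat) (m_gt0 : (0 < m)%N) (n_gt0 : (0 < n)%N) :
  process (fractal_multimap w alpha m n).
Proof.
have FZ D l f : l != 0 -> fractal_function w alpha m n D (l *: f) =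
    l *: fractal_function w alpha m n D f.
  by move=> l0; apply: fractal_functionZ => //; exact: ltW.
split=> [f l l0|].
  have lne0 : l != 0 by rewrite gt_eqF.
  (* Both inclusions keep the same net [D] and apply homogeneity to it. *)
  apply/seteqP; split=> [_ [_ [D _ <-] <-]|_ [D _ <-]].
    by exists D; rewrite // FZ.
  by exists (fractal_function w alpha m n D f); [exists D|rewrite FZ].
(* Membership of 0 in the image of 0 requires some net to exist; the midpoint net serves. *)
pose D := Net (itv_partition_mid _ _ _ ab) (itv_partition_mid _ _ _ cd) isT isT.
exists D => //.
(* A fixed point of doubling is 0. *)
have := FZ D 2 0; rewrite scaler0 pnatr_eq0 scaler_nat mulr2n => /(_ isT)/eqP.
by rewrite -subr_eq0 opprD addrA subrr sub0r oppr_eq0 => /eqP.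
Qed.
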